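(* Let $\zeta>0$ and let $n\ge0$ be an integer. (i) Two three-term recurrence relations between $\{P_n^{(0)}(x;\zeta)\}$ and $\{P_n^{(1)}(x;\zeta)\}$ are $$(x^2-1)P_n^{(1)}=p_nP_n^{(0)}+q_nP_{n+1}^{(0)}+r_{n+1}P_{n+2}^{(0)},\qquad P_{n+1}^{(0)}=r_nP_{n-1}^{(1)}+q_nP_n^{(1)}+p_{n+1}P_{n+1}^{(1)},$$ or in matrix-vector form $$\vec P_{n+1}^{(0)}=\vec J_n^T\vec P_n^{(1)}+p_{n+1}P_{n+1}^{(1)}\vec e_{n+2},\qquad (x^2-1)\vec P_n^{(1)}=\vec J_n\vec P_{n+1}^{(0)}+r_{n+1}P_{n+2}^{(0)}\vec e_{n+1},$$ where $$p_n=\frac{c_n^{(0)}}{c_n^{(1)}},\quad q_n=\frac{c_n^{(1)}}{c_{n+1}^{(0)}}\Big(\sum_{i=1}^{n+2}x_{i,n+2}^{(0)}-\sum_{i=1}^nx_{i,n}^{(1)}\Big)=\frac{c_{n+1}^{(0)}}{c_n^{(1)}}\sum_{i=1}^{n+1}\big(x_{i,n+1}^{(1)}-x_{i,n+1}^{(0)}\big),\quad r_n=\frac{c_{n-1}^{(1)}}{c_{n+1}^{(0)}},$$ and $\vec J_n\in\mathbb R^{(n+1)\times(n+2)}$ is the matrix with entries (rows $k=0,\dots,n$, columns $j=0,\dots,n+1$) $p_k$ at $(k,k)$, $q_k$ at $(k,k+1)$, $r_{k+1}$ at $(k,k+2)$ when $k+2\le n+1$, and $0$ elsewhere. (ii)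 Two two-term recurrence relations between $\{P_n^{(0)}(x;\zeta)\}$ and $\{P_n^{(1)}(x;\zeta)\}$ are $$(x^2-1)P_n^{(1)}=\tilde p_n(x+\tilde q_n)P_{n+1}^{(0)}+\tilde r_nP_n^{(0)},\qquad P_{n+1}^{(0)}=\frac1{\tilde p_n}(x-\tilde q_n)P_n^{(1)}-\frac{a_{n-1}^{(1)}}{a_n^{(0)}}\tilde r_nP_{n-1}^{(1)},$$ where $$\tilde p_n=\frac{c_n^{(1)}}{c_{n+1}^{(0)}},\qquad \tilde q_n=\sum_{i=1}^{n+1}x_{i,n+1}^{(0)}-\sum_{i=1}^nx_{i,n}^{(1)},\qquad \tilde r_n=p_n(1-\tilde p_n^2).$$
   Context: For $\zeta>0$ let $K_1(\zeta)=\int_0^\infty\cosh(\vartheta)e^{-\zeta\cosh\vartheta}d\vartheta$. For $\ell\in\{0,1\}$ let $\omega^{(\ell)}(x;\zeta)=K_1(\zeta)^{-1}(x^2-1)^{\ell-1/2}e^{-\zeta x}$ on $[1,\infty)$ and $(f,g)_{\omega^{(\ell)}}=\int_1^\infty f(x)g(x)\omega^{(\ell)}(x;\zeta)dx$. $\{P_n^{(\ell)}(x;\zeta)\}_{n\ge0}$ are the orthonormal polynomials in $x$ for $(\cdot,\cdot)_{\omega^{(\ell)}}$, $\deg P_n^{(\ell)}=n$, with leading coefficient $c_n^{(\ell)}=c_n^{(\ell)}(\zeta)>0$. $P_n^{(\ell)}$ has exactly $n$ simple real zeros $x_{1,n}^{(\ell)}<\dots<x_{n,n}^{(\ell)}$,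 all in $(1,\infty)$. $a_n^{(\ell)}:=c_n^{(\ell)}/c_{n+1}^{(\ell)}$ (this is the off-diagonal coefficient $(xP_n^{(\ell)},P_{n+1}^{(\ell)})_{\omega^{(\ell)}}$ of the usual three-term recurrence). $\vec P_n^{(\ell)}=(P_0^{(\ell)},\dots,P_n^{(\ell)})^T$; $\vec e_k$ is the last column of the identity matrix of order $k$. Conventions: $P_{-1}^{(\ell)}=0$ (so terms multiplied by $P_{-1}^{(1)}$ vanish; $r_0$ and $a_{-1}^{(1)}$ are irrelevant), empty sums are $0$. *)

(* Defs.v *)
From HB Require Import structures.
From mathcomp Require Import all_boot all_order all_algebra.
From mathcomp Require Import polyrcf.
From mathcomp Require Import all_classical all_reals all_analysis.
Set Implicit Arguments.
Unset Strict Implicit.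
Unset Printing Implicit Defensive.
Import Order.TTheory GRing.Theory Num.Theory.
Local Open Scope classical_set_scope.
Local Open Scope ring_scope.

Section Weight.
Variable R : realType.

Definition cosh (t : R) : R := (expR t + expR (- t)) / 2.

(* The modified Bessel function K_1. *)
Definition besselK1 (zeta : R) : R :=
  \int[lebesgue_measure]_(t in `[0, +oo[) (cosh t * expR (- zeta * cosh t)).

(* Only meant for x >= 1 and l = 0, 1.  As 0 `^ a = 0 for a <> 0, the weight is
   0 at the singular point x = 1, which has measure 0. *)
Definition weight (l : nat) (zeta x : R) : R :=
  (besselK1 zeta)^-1 * (x ^+ 2 - 1) `^ (l%:R - 1 / 2) * expR (- zeta * x).

Definition inner (w f g : R -> R) : R :=
  \int[lebesgue_measure]_(x in `[1, +oo[) (f x * g x * w x).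

(* P is the sequence of orthonormal polynomials for the weight w; these
   conditions determine P uniquely. *)
Record orthonormal_polys (w : R -> R) (P : nat -> {poly R}) : Prop := {
  size_op : forall n, size (P n) = n.+1;
  lead_op : forall n, 0 < lead_coef (P n);
  inner_op : forall m n, inner w (horner (P m)) (horner (P n)) = (m == n)%:R }.

End Weight.

Section Coefficients.
Variable R : realType.

(* [rootsR] is the increasing list of the distinct real roots and [i] is
   0-based: [zero_op (P n) i] is x_{i+1,n}. *)
Definition zero_op (f : {poly R}) (i : nat) : R := (rootsR f)`_i.

(* P_{n-1}, with P_{-1} = 0. *)
Definition prev_op (P : nat -> {poly R}) (n : nat) : {poly R} :=
  if n is m.+1 then P m else 0.

Definition acoef (P : nat -> {poly R}) (n : nat) : R :=
  lead_coef (P n) / lead_coef (P n.+1).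

Variables P0 P1 : nat -> {poly R}.

Definition pcoef (n : nat) : R := lead_coef (P0 n) / lead_coef (P1 n).

Definition qcoef (n : nat) : R :=
  lead_coef (P1 n) / lead_coef (P0 n.+1) *
  (\sum_(i < n.+2) zero_op (P0 n.+2) i - \sum_(i < n) zero_op (P1 n) i).

(* r_0 = 0 here, but r_0 only ever multiplies P_{-1} = 0. *)
Definition rcoef (n : nat) : R :=
  lead_coef (prev_op P1 n) / lead_coef (P0 n.+1).

Definition Jmx (n : nat) : 'M[R]_(n.+1, n.+2) :=
  \matrix_(k, j)
    if j == k :> nat then pcoef k
    else if j == k.+1 :> nat then qcoef k
    else if j == k.+2 :> nat then rcoef k.+1
    else 0.

Definition ptilde (n : nat) : R := lead_coef (P1 n) / lead_coef (P0 n.+1).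

Definition qtilde (n : nat) : R :=
  \sum_(i < n.+1) zero_op (P0 n.+1) i - \sum_(i < n) zero_op (P1 n) i.

Definition rtilde (n : nat) : R := pcoef n * (1 - ptilde n ^+ 2).

End Coefficients.

Section PolynomialVectors.
Variable R : realType.

Definition pvec (P : nat -> {poly R}) (n : nat) : 'cV[{poly R}]_n.+1 :=
  \col_(i < n.+1) P i.

(* e_{k+1}, of order k + 1. *)
Definition elast (k : nat) : 'cV[{poly R}]_k.+1 := col ord_max 1%:M.

Definition polymx (m n : nat) (A : 'M[R]_(m, n)) : 'M[{poly R}]_(m, n) :=
  map_mx polyC A.

End PolynomialVectors.

(* Main.v *)
Require Import Defs.
From HB Require Import structures.
From mathcomp Require Import all_boot all_order all_algebra ring lra.
From mathcomp Require Import polyrcf complex.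
From mathcomp Require Import all_classical all_reals all_analysis.
From mathcomp Require Import measurable_realfun.
Import Order.TTheory GRing.Theory Num.Theory.
Local Open Scope ring_scope.
Set Implicit Arguments.
Unset Strict Implicit.
Unset Printing Implicit Defensive.

(** Why the theorem holds.  On [1, oo) the two weights differ by the factor
x^2 - 1, so both orthonormal systems come from one linear functional L on
polynomials, integration against the weight of index 0: P0 is orthonormal for
(f, g) |-> L (f g) and P1 for (f, g) |-> L ((x^2 - 1) f g).  Everything except
the construction of L is linear algebra of polynomials.

The polynomial (x^2 - 1) P1_n has degree n + 2 and is orthogonal to all
polynomials of degree < n, hence it is a combination of P0_n, P0_{n+1} and
P0_{n+2}.  Symmetrically, P0_{n+1} is a combination of P1_{n-1}, P1_n and
P1_{n+1}, and its coefficients are the same numbers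
L (P0_j (x^2 - 1) P1_k).  When k = j or k = j - 2 this number is the pairing
of an orthonormal polynomial with a polynomial of the same degree, that is, a
quotient of leading coefficients (onf_inner_coef).  The middle coefficient
q_n is found by comparing the second highest coefficients of either relation,
which gives its two expressions (X2sub1M_expand, qcoefE).  For the two-term
relations, a multiple of x P0_{n+1} is subtracted from (x^2 - 1) P1_n, or of
x P1_n from P0_{n+1}, so as to cancel the leading term; what is left has only
two components, found in the same way.

The second highest coefficient is minus the leading one times the sum of the
zeros because P_n has n distinct real zeros (onf_factor).  This uses only that
L (f^2) > 0 for f <> 0: if P_n had a double or a non-real zero, it would have
a factor D = (x - a)^2 + b^2, say P_n = D g, and orthogonality of P_n to g
would contradict L (P_n g) = L (((x - a) g)^2) + b^2 L (g^2) > 0.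

Integration is linear on polynomials as soon as each of them is integrable
against the weight, and this follows from the mere existence of the
orthonormal system (moment_integrable). *)

(** * Degrees, coefficients and real quadratic factors *)

Lemma size_sub_top (F : fieldType) (p f : {poly F}) n :
  size p = n.+1 -> (size f <= n.+1)%N ->
  (size (f - (f`_n / lead_coef p) *: p)%R <= n)%N.
Proof.
move=> sp sf; apply/leq_sizeP => k; rewrite leq_eqVlt => /predU1P[<-|nk].
  rewrite !coefE lead_coefE sp mulfVK ?subrr//.
  by rewrite -[n]/n.+1.-1 -sp -lead_coefE lead_coef_eq0 -size_poly_gt0 sp.
rewrite coefB coefZ (nth_default _ (leq_trans sf nk)).
by rewrite [X in _ * X]nth_default ?mulr0 ?subrr ?sp.
Qed.

Lemma size_X2sub1M (R : nzRingType) (f : {poly R}) :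
  (size (('X^2 - 1) * f)%R <= (size f).+2)%N.
Proof. by apply: leq_trans (size_polyMleq _ _) _; rewrite size_XnsubC. Qed.

Lemma size_XM (R : nzRingType) (f : {poly R}) :
  (size ('X * f)%R <= (size f).+1)%N.
Proof. by apply: leq_trans (size_polyMleq _ _) _; rewrite size_polyX. Qed.

Lemma mulX_swap (R : comNzRingType) (f g : {poly R}) :
  f * ('X * g) = g * ('X * f).
Proof. ring. Qed.

Lemma coef_X2sub1M (R : nzRingType) (f : {poly R}) k :
  (('X^2 - 1) * f)`_k.+2 = f`_k - f`_k.+2.
Proof. by rewrite mulrBl mul1r coefB coefXnM /= subn2. Qed.

Lemma size_sqr_XsubC_addC (R : nzRingType) (a c : R) :
  size (('X - a%:P) ^+ 2 + c%:P) = 3%N.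
Proof.
by rewrite size_polyDl size_exp_XsubC ?(leq_ltn_trans (size_polyC_leq1 _)).
Qed.

(** The remainder modulo the quadratic is u + v x with u, v real, and it
vanishes at a + i b; the imaginary part v b forces v = 0, then u = 0. *)
Lemma complex_root_dvdp (R : rcfType) (p : {poly R}) (a b : R) :
  b != 0 -> root (map_poly (real_complex R) p) (a +i* b)%C ->
  ('X - a%:P) ^+ 2 + (b ^+ 2)%:P %| p.
Proof.
move=> b0 /rootP pz0; set D := _ + _.
have sD : size D = 3%N by exact: size_sqr_XsubC_addC.
have D0 : D != 0 by rewrite -size_poly_gt0 sD.
have Dz0 : (map_poly (real_complex R) D).[(a +i* b)%C] = 0.
  rewrite /D rmorphD rmorphXn rmorphB /= map_polyX !map_polyC /= !hornerE.
  apply/eqP; rewrite expr2 eq_complex /= !subrr !subr0 mul0r mulr0 !addr0.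
  by rewrite sub0r -expr2 addNr mul0r eqxx.
rewrite /dvdp; set r := p %% D.
have sr : (size r <= 2)%N by rewrite -ltnS -sD ltn_modp.
have rE : r = (r`_0)%:P + r`_1 *: 'X.
  apply/polyP => -[|[|i]]; rewrite !coefE //= ?mulr0 ?mulr1 ?addr0 ?add0r //.
  by rewrite nth_default// (leq_trans sr).
have : (map_poly (real_complex R) r).[(a +i* b)%C] = 0.
  move: pz0; rewrite {1}(divp_eq p D) rmorphD rmorphM /= !hornerE Dz0 mulr0.
  by rewrite add0r.
rewrite rE rmorphD /= map_polyC /= linearZ /= map_polyX !hornerE.
move=> /eqP; rewrite eq_complex /= !mul0r !addr0 subr0 add0r mulf_eq0.
rewrite (negPf b0) orbF => /andP[+ /eqP r1]; rewrite r1 mul0r addr0 => /eqP r0.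
by rewrite r0 scale0r addr0 polyC0.
Qed.

(** * Polynomials orthonormal for a linear functional *)

(** The inner product (f, g) |-> L (f g) is kept as a functional of the
product, so that moving a polynomial factor from one side to the other is
commutativity of multiplication. *)
Record orthonormal_for (R : numDomainType) (L : {scalar {poly R}})
    (P : nat -> {poly R}) : Prop := {
  onf_size : forall n, size (P n) = n.+1;
  onf_lead : forall n, 0 < lead_coef (P n);
  onf_inner : forall m n, L (P m * P n) = (m == n)%:R }.

Section OrthonormalFor.
Variables (R : realFieldType) (L : {scalar {poly R}}) (P : nat -> {poly R}).
Hypothesis oP : orthonormal_for L P.

Lemma onf_lead_neq0 n : lead_coef (P n) != 0.
Proof. by rewrite lt0r_neq0 ?(onf_lead oP). Qed.

Lemma onf_coef n : (P n)`_n = lead_coef (P n).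
Proof. by rewrite lead_coefE (onf_size oP). Qed.

Lemma onf_orth n (f : {poly R}) : (size f <= n)%N -> L (P n * f) = 0.
Proof.
suff H m : (m <= n)%N -> (size f <= m)%N -> L (P n * f) = 0 by exact: H.
elim: m f => [|m IHm] f mn sf.
  by move: sf; rewrite leqn0 size_poly_eq0 => /eqP ->; rewrite mulr0 linear0.
have /(IHm _ (ltnW mn)) := size_sub_top (onf_size oP _) sf.
rewrite mulrBr linearB /= -scalerAr linearZ /= (onf_inner oP) gtn_eqF//.
by rewrite mulr0 subr0.
Qed.

(** Modulo lower degrees, f is f`_n / c_n times P_n. *)
Lemma onf_inner_coef n (f : {poly R}) : (size f <= n.+1)%N ->
  L (P n * f) = f`_n / lead_coef (P n).
Proof.
move=> sf; have := onf_orth (size_sub_top (onf_size oP _) sf).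
rewrite mulrBr linearB /= -scalerAr linearZ /= (onf_inner oP) eqxx mulr1.
by move/eqP; rewrite subr_eq0 => /eqP.
Qed.

Lemma onf_expand N (f : {poly R}) : (size f <= N)%N ->
  f = \sum_(i < N) L (P i * f) *: P i.
Proof.
elim: N f => [|N IHN] f sf.
  by move: sf; rewrite leqn0 size_poly_eq0 big_ord0 => /eqP.
rewrite big_ord_recr /= onf_inner_coef//.
have /IHN := size_sub_top (onf_size oP _) sf; set g := _ - _ => gE.
rewrite -[LHS](subrK ((f`_N / lead_coef (P N)) *: P N)) -/g gE; congr (_ + _).
apply: eq_bigr => i _; congr (_ *: _).
rewrite /g mulrBr linearB /= -scalerAr linearZ /= (onf_inner oP).
by rewrite ltn_eqF ?mulr0n ?mulr0 ?subr0.
Qed.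

Lemma onf_expand2 n (f : {poly R}) : (size f <= n.+2)%N ->
  (forall i, (i < n)%N -> L (P i * f) = 0) ->
  f = L (P n * f) *: P n + L (P n.+1 * f) *: P n.+1.
Proof.
move=> /onf_expand fE f0; rewrite {1}fE !big_ord_recr /= big1 ?add0r// => i _.
by rewrite f0 ?scale0r.
Qed.

(** With f = t P_n + g, deg g < n, orthogonality gives L (f^2) = t^2 + L (g^2).
*)
Lemma onf_sqr_gt0 (f : {poly R}) : f != 0 -> 0 < L (f ^+ 2).
Proof.
have [n] := ubnP (size f).
elim: n f => // n IHn f; rewrite ltnS => sf f0.
case: n IHn sf => [|n] IHn sf.
  by rewrite leqn0 size_poly_eq0 (negPf f0) in sf.
set t := f`_n / lead_coef (P n).
have := size_sub_top (onf_size oP _) sf; rewrite -/t; set g := f - _ => sg.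
have -> : L (f ^+ 2) = t ^+ 2 + L (g ^+ 2).
  have -> : f ^+ 2 = t ^+ 2 *: (P n * P n) + t *: (P n * g) *+ 2 + g ^+ 2.
    by rewrite -[f in LHS](subrK (t *: P n)) -/g -!mul_polyC; ring.
  rewrite !linearD !linearZ /= (onf_inner oP) eqxx onf_orth// mulr1.
  by rewrite mulr0 !addr0.
have [g0|g0] := eqVneq g 0; last first.
  by rewrite ltr_wpDl ?sqr_ge0// IHn.
rewrite g0 expr0n linear0 addr0 exprn_even_gt0//=.
apply: contraNneq f0 => t0.
by move: g0; rewrite /g t0 scale0r subr0 => ->.
Qed.

(** For b = 0 this excludes double real zeros, for b <> 0 non-real ones: if
P_n = D g, then P_n is orthogonal to g, whereas D g^2 is a sum of squares. *)
Lemma onf_no_quadratic_factor n a b :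
  ~~ (('X - a%:P) ^+ 2 + (b ^+ 2)%:P %| P n).
Proof.
apply/negP; set D := _ + _ => /dvdpP[g gE].
have sD : size D = 3%N by exact: size_sqr_XsubC_addC.
have P0 : P n != 0 by rewrite -size_poly_gt0 (onf_size oP).
have g0 : g != 0 by apply: contraNneq P0 => g0; rewrite gE g0 mul0r.
have sg : (size g <= n)%N.
  have : size (P n) = (size g).+2.
    by rewrite gE size_mul// ?sD ?addn3// -size_poly_gt0 sD.
  by rewrite (onf_size oP) => -[->].
have := onf_orth sg; rewrite gE.
have -> : g * D * g = (('X - a%:P) * g) ^+ 2 + b ^+ 2 *: g ^+ 2.
  by rewrite /D -mul_polyC; ring.
rewrite linearD linearZ /= => /eqP; rewrite gt_eqF// ltr_pwDl//.
  by rewrite onf_sqr_gt0// mulf_neq0// polyXsubC_eq0.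
by rewrite mulr_ge0 ?sqr_ge0// ltW// onf_sqr_gt0.
Qed.

End OrthonormalFor.

(** * Zeros of orthonormal polynomials *)

Section Zeros.
Variables (R : realType) (L : {scalar {poly R}}) (P : nat -> {poly R}).
Hypothesis oP : orthonormal_for L P.

(** Stated with P_{n-1} = 0 for n = 0, so that expansions in P1 need no case
distinction. *)
Lemma onf_expand3 n (f : {poly R}) : (size f <= n.+2)%N ->
  (forall i, (i.+1 < n)%N -> L (P i * f) = 0) ->
  f = L (prev_op P n * f) *: prev_op P n + L (P n * f) *: P n
      + L (P n.+1 * f) *: P n.+1.
Proof.
case: n => [|n] sf f0 /=; first by rewrite scaler0 add0r; apply: onf_expand2.
rewrite {1}(onf_expand oP sf) !big_ord_recr /= big1 ?add0r// => i _.
by rewrite f0 ?scale0r// ltnS.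
Qed.

(** Dividing P_n by the product of (x - z) over its distinct real zeros leaves a
constant: a complex zero of the quotient h would be a non-real zero of P_n, or
a real zero of P_n of multiplicity at least 2. *)
Lemma onf_factor n : size (rootsR (P n)) = n /\
  P n = lead_coef (P n) *: \prod_(z <- rootsR (P n)) ('X - z%:P).
Proof.
have P0 : P n != 0 by rewrite -size_poly_gt0 (onf_size oP).
have mem_rs x : (x \in rootsR (P n)) = root (P n) x.
  by have := roots_on_rootsR P0 x; rewrite in_itv /= => <-.
have rrs : all (root (P n)) (rootsR (P n)).
  by apply/allP => x; rewrite mem_rs.
have urs : poly.uniq_roots (rootsR (P n)) by rewrite uniq_rootsE uniq_roots.
have [h hE] := uniq_roots_prod_XsubC rrs urs.
have sh : size h = 1%N.
  apply/eqP; apply/negPn/negP => sh1.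
  (* h has a zero a + i b because R[i] is algebraically closed. *)
  have /closed_rootP[[a b] hz] : size (map_poly (real_complex R) h) != 1%N.
    by rewrite size_map_poly.
  have /negP[] := onf_no_quadratic_factor oP n a b.
  have [b0|b0] := eqVneq b 0; last first.
    by apply: complex_root_dvdp => //; rewrite hE rmorphM rootM hz.
  have ha : root h a by move: hz; rewrite b0 fmorph_root.
  rewrite b0 expr0n addr0 expr2 hE dvdp_mul// dvdp_XsubCl//.
  by rewrite root_prod_XsubC mem_rs hE rootM ha.
have szrs : size (rootsR (P n)) = n.
  apply/eqP; rewrite -eqSS -(onf_size oP n) [in X in _ == X]hE.
  rewrite size_Mmonic ?monic_prod_XsubC -?size_poly_gt0 ?sh//.
  by rewrite size_prod_XsubC add1n.
by split => //; apply: all_roots_prod_XsubC; rewrite ?szrs ?(onf_size oP).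
Qed.

(** The factor 'X turns the coefficient of degree n - 1 into one of index n,
which is 0 for n = 0, in agreement with the empty sum. *)
Lemma onf_subleading n :
  ('X * P n)`_n = - (lead_coef (P n) * \sum_(i < n) zero_op (P n) i).
Proof.
have [srs PE] := onf_factor n.
rewrite coefXM; case: n srs PE => [|n] srs PE.
  by rewrite big_ord0 mulr0 oppr0.
rewrite [in LHS]PE coefZ -mulrN /=; congr (_ * _).
have := @coefPn_prod_XsubC _ (rootsR (P n.+1)); rewrite srs => -> //.
by rewrite (big_nth 0) srs big_mkord.
Qed.

End Zeros.

(** * Recurrence relations between the two systems *)

Definition mul_functional (R : comNzRingType) (m : {poly R})
  (L : {scalar {poly R}}) : {scalar {poly R}} := L \o (m \*o idfun).

Lemma mul_functionalM (R : comNzRingType) (m : {poly R})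
    (L : {scalar {poly R}}) (f g : {poly R}) :
  mul_functional m L (f * g) = L (f * (m * g)).
Proof. by rewrite /= mulrCA. Qed.

Lemma size_prev (R : realType) (P : nat -> {poly R}) n :
  (forall k, size (P k) = k.+1) -> size (prev_op P n) = n.
Proof. by move=> sP; case: n => [|n] /=; rewrite ?sP ?size_poly0. Qed.

Section Connection.
Variables (R : realType) (L : {scalar {poly R}}) (P0 P1 : nat -> {poly R}).
Hypothesis oP0 : orthonormal_for L P0.
Hypothesis oP1 : orthonormal_for (mul_functional ('X^2 - 1) L) P1.

Local Notation zsum P n := (\sum_(i < n) zero_op (P n) i).
Local Notation c0 n := (lead_coef (P0 n)).
Local Notation c1 n := (lead_coef (P1 n)).

Let c0_neq0 n : c0 n != 0 := onf_lead_neq0 oP0 n.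
Let c1_neq0 n : c1 n != 0 := onf_lead_neq0 oP1 n.

Lemma inner_X2sub1_diag n : L (P0 n * (('X^2 - 1) * P1 n)) = pcoef P0 P1 n.
Proof.
rewrite -mul_functionalM mulrC (onf_inner_coef oP1) ?(onf_size oP0)//.
by rewrite (onf_coef oP0).
Qed.

Lemma inner_X2sub1_top n :
  L (P0 n.+1 * (('X^2 - 1) * prev_op P1 n)) = rcoef P0 P1 n.
Proof.
rewrite (onf_inner_coef oP0); last first.
  by apply: leq_trans (size_X2sub1M _) _; rewrite (size_prev _ (onf_size oP1)).
rewrite /rcoef; congr (_ / _); case: n => [|n] /=.
  by rewrite mulr0 coef0 lead_coef0.
rewrite coef_X2sub1M (onf_coef oP1).
by rewrite [X in _ - X]nth_default ?subr0 ?(onf_size oP1).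
Qed.

Lemma subleading_X2sub1M n :
  (('X^2 - 1) * P1 n)`_n.+1 = - (c1 n * zsum P1 n).
Proof.
have -> : (('X^2 - 1) * P1 n)`_n.+1 = ('X * (('X^2 - 1) * P1 n))`_n.+2.
  by rewrite coefXM.
rewrite -(onf_subleading oP1) mulrCA coef_X2sub1M [X in _ - X]coefXM /=.
by rewrite [X in _ - X]nth_default ?subr0 ?(onf_size oP1).
Qed.

Lemma subleadingS (P : nat -> {poly R}) (L' : {scalar {poly R}}) n :
  orthonormal_for L' P -> (P n.+1)`_n = - (lead_coef (P n.+1) * zsum P n.+1).
Proof. by move=> oP; rewrite -(onf_subleading oP) coefXM. Qed.

(** The outer coefficients are inner products of known value; the middle one
is determined by the coefficients of degree n + 1. *)
Lemma X2sub1M_expand n : ('X^2 - 1) * P1 n =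
  pcoef P0 P1 n *: P0 n + qcoef P0 P1 n *: P0 n.+1
  + rcoef P0 P1 n.+1 *: P0 n.+2.
Proof.
set f := ('X^2 - 1) * P1 n.
have fE : f = pcoef P0 P1 n *: P0 n + L (P0 n.+1 * f) *: P0 n.+1
              + rcoef P0 P1 n.+1 *: P0 n.+2.
  rewrite {1}[f](@onf_expand3 _ _ _ oP0 n.+1).
  - by rewrite /= inner_X2sub1_diag -inner_X2sub1_top.
  - by apply: leq_trans (size_X2sub1M _) _; rewrite (onf_size oP1).
  - move=> i ni; rewrite -mul_functionalM mulrC.
    by rewrite (onf_orth oP1)// (onf_size oP0).
suff <- : L (P0 n.+1 * f) = qcoef P0 P1 n by [].
have := subleading_X2sub1M n; rewrite -/f {1}fE !coefD !coefZ.
rewrite (subleadingS _ oP0) (onf_coef oP0) [X in _ * X + _ + _]nth_default.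
  rewrite /qcoef /rcoef /= => e.
  apply: (mulIf (c0_neq0 n.+1)).
  have -> : L (P0 n.+1 * f) * c0 n.+1 = - (c1 n * zsum P1 n)
     + c1 n / c0 n.+2 * (c0 n.+2 * zsum P0 n.+2) by rewrite -e; ring.
  by field; rewrite c0_neq0 c0_neq0.
by rewrite (onf_size oP0).
Qed.

Lemma inner_X2sub1_mid n : L (P0 n.+1 * (('X^2 - 1) * P1 n)) = qcoef P0 P1 n.
Proof.
rewrite X2sub1M_expand !mulrDr !linearD /= -!scalerAr !linearZ /=.
rewrite !(onf_inner oP0).
by rewrite eqxx gtn_eqF// ltn_eqF// !mulr0 mulr1 add0r addr0.
Qed.

(** The coefficients are the inner products L (P0_{n+1} (x^2 - 1) P1_k) for
k = n - 1, n, n + 1, which are also coefficients in X2sub1M_expand for n - 1,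
n and n + 1. *)
Lemma P0_expand n : P0 n.+1 =
  rcoef P0 P1 n *: prev_op P1 n + qcoef P0 P1 n *: P1 n
  + pcoef P0 P1 n.+1 *: P1 n.+1.
Proof.
rewrite {1}[P0 n.+1](@onf_expand3 _ _ _ oP1 n) ?(onf_size oP0)//.
  rewrite -inner_X2sub1_top -inner_X2sub1_mid -inner_X2sub1_diag.
  by rewrite -!mul_functionalM ![P0 _ * _]mulrC.
move=> i ni; rewrite mulrC mul_functionalM (onf_orth oP0)//.
by apply: leq_trans (size_X2sub1M _) _; rewrite (onf_size oP1).
Qed.

(** Here P0_expand is compared in degree n. *)
Lemma qcoefE n : qcoef P0 P1 n = c0 n.+1 / c1 n *
  \sum_(i < n.+1) (zero_op (P1 n.+1) i - zero_op (P0 n.+1) i).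
Proof.
have := subleadingS n oP0; rewrite {1}P0_expand !coefD !coefZ.
rewrite (subleadingS _ oP1) (onf_coef oP1).
rewrite [X in _ * X + _ + _]nth_default; last first.
  by rewrite (size_prev _ (onf_size oP1)).
rewrite sumrB mulr0 add0r => e; apply: (mulIf (c1_neq0 n)).
have -> : qcoef P0 P1 n * c1 n = - (c0 n.+1 * zsum P0 n.+1)
  + pcoef P0 P1 n.+1 * (c1 n.+1 * zsum P1 n.+1) by rewrite -e; ring.
by rewrite /pcoef; field; rewrite !c1_neq0.
Qed.

Lemma inner_X (P : nat -> {poly R}) (L' : {scalar {poly R}}) n :
  orthonormal_for L' P -> L' (P n.+1 * ('X * P n)) = acoef P n.
Proof.
move=> oP; rewrite (onf_inner_coef oP) ?coefXM /= ?(onf_coef oP)//.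
by apply: leq_trans (size_XM _) _; rewrite (onf_size oP).
Qed.

(** The multiple of x P0_{n+1} is the one that cancels the term of degree
n + 2.  The difference g is still orthogonal to degrees < n; its component
along P0_{n+1} is read off its coefficient of degree n + 1. *)
Lemma X2sub1M_two_term n : ('X^2 - 1) * P1 n =
  ptilde P0 P1 n *: (('X + (qtilde P0 P1 n)%:P) * P0 n.+1)
  + rtilde P0 P1 n *: P0 n.
Proof.
set f := ('X^2 - 1) * P1 n; set pt := ptilde P0 P1 n; set qt := qtilde P0 P1 n.
set g := f - pt *: ('X * P0 n.+1).
have gn2 : g`_n.+2 = 0.
  rewrite coefB coefZ coefXM /= coef_X2sub1M (onf_coef oP1) (onf_coef oP0).
  by rewrite [X in _ - X - _]nth_default ?(onf_size oP1)// subr0 divfK ?subrr.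
have sg : (size g <= n.+2)%N.
  apply/leq_sizeP => k; rewrite leq_eqVlt => /predU1P[<-//|nk].
  rewrite nth_default// (leq_trans _ nk)// (leq_trans (size_polyD _ _))//.
  rewrite geq_max size_polyN (leq_trans (size_X2sub1M _)) ?(onf_size oP1)//=.
  rewrite (leq_trans (size_scale_leq _ _))// (leq_trans (size_XM _))//.
  by rewrite (onf_size oP0).
have gorth i : (i < n)%N -> L (P0 i * g) = 0.
  move=> ni; rewrite mulrBr linearB /= -scalerAr linearZ /=.
  rewrite -mul_functionalM mulrC (onf_orth oP1) ?(onf_size oP0)//.
  rewrite (mulX_swap (P0 i)).
  rewrite (onf_orth oP0) ?mulr0 ?subr0//.
  by rewrite (leq_trans (size_XM _))// (onf_size oP0).
have := onf_expand2 oP0 sg gorth.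
have -> : L (P0 n * g) = rtilde P0 P1 n.
  rewrite mulrBr linearB /= -scalerAr linearZ /= inner_X2sub1_diag.
  rewrite (mulX_swap (P0 n)) (inner_X _ oP0).
  by rewrite /rtilde /pt /ptilde /pcoef /acoef; field; rewrite c0_neq0 c1_neq0.
move=> gE.
suff gA : L (P0 n.+1 * g) = pt * qt.
  move: gE; rewrite gA /g => /eqP; rewrite subr_eq => /eqP ->.
  by rewrite mulrDl scalerDr mul_polyC scalerA [LHS]addrC addrA addrAC.
apply: (mulIf (c0_neq0 n.+1)).
have : g`_n.+1 = - (c1 n * zsum P1 n) + pt * (c0 n.+1 * zsum P0 n.+1).
  rewrite coefB coefZ subleading_X2sub1M coefXM /= (subleadingS _ oP0).
  by rewrite mulrN opprK.
rewrite {1}gE coefD !coefZ (onf_coef oP0).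
rewrite [X in _ * X + _]nth_default ?(onf_size oP0)//.
rewrite mulr0 add0r => ->.
by rewrite /qt /qtilde /pt /ptilde; field; rewrite c0_neq0.
Qed.

(** The component along P1_{n-1} of the remainder in P0_two_term.  The two
sides are only compared after scaling P1_{n-1}: for n = 0 the
coefficients themselves need not agree. *)
Lemma two_term_last n (L1 := mul_functional ('X^2 - 1) L) :
  (L1 (prev_op P1 n * P0 n.+1)
   - (ptilde P0 P1 n)^-1 * L1 (prev_op P1 n * ('X * P1 n))) *: prev_op P1 n =
  - (acoef P1 n.-1 / acoef P0 n * rtilde P0 P1 n) *: prev_op P1 n.
Proof.
case: n => [|m]; first by rewrite !scaler0.
congr (_ *: _).
rewrite mulX_swap (inner_X _ oP1) [prev_op _ _ * _]mulrC mul_functionalM.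
rewrite (inner_X2sub1_top m.+1) /rcoef /acoef /rtilde /pcoef /ptilde /=.
by field; rewrite !c0_neq0 !c1_neq0.
Qed.

(** The multiple of x P1_n cancels the leading term of P0_{n+1}; the remainder
has degree <= n and is orthogonal to P1_k for k < n - 1. *)
Lemma P0_two_term n : P0 n.+1 =
  (ptilde P0 P1 n)^-1 *: (('X - (qtilde P0 P1 n)%:P) * P1 n)
  - (acoef P1 n.-1 / acoef P0 n * rtilde P0 P1 n) *: prev_op P1 n.
Proof.
set pt := ptilde P0 P1 n; set qt := qtilde P0 P1 n.
have pt0 : pt != 0 by rewrite mulf_neq0 ?invr_eq0.
set g := P0 n.+1 - pt^-1 *: ('X * P1 n).
have gn1 : g`_n.+1 = 0.
  rewrite coefB coefZ coefXM /= (onf_coef oP1) (onf_coef oP0) /pt /ptilde.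
  by field; rewrite c0_neq0 c1_neq0.
have sg : (size g <= n.+1)%N.
  apply/leq_sizeP => k; rewrite leq_eqVlt => /predU1P[<-//|nk].
  rewrite nth_default// (leq_trans _ nk)// (leq_trans (size_polyD _ _))//.
  rewrite geq_max size_polyN (onf_size oP0) leqnn /=.
  rewrite (leq_trans (size_scale_leq _ _))// (leq_trans (size_XM _))//.
  by rewrite (onf_size oP1).
set L1 := mul_functional ('X^2 - 1) L.
have gL f : L1 (f * g) = L1 (f * P0 n.+1) - pt^-1 * L1 (f * ('X * P1 n)).
  by rewrite mulrBr linearB -scalerAr linearZ.
have gorth i : (i.+1 < n)%N -> L1 (P1 i * g) = 0.
  move=> ni; rewrite gL [P1 i * P0 _]mulrC mul_functionalM.
  rewrite (onf_orth oP0); last first.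
    by apply: leq_trans (size_X2sub1M _) _; rewrite (onf_size oP1).
  rewrite (mulX_swap (P1 i)).
  rewrite (onf_orth oP1) ?mulr0 ?subr0//.
  by rewrite (leq_trans (size_XM _))// (onf_size oP1).
have := onf_expand3 oP1 (leqW sg) gorth; rewrite -/L1.
rewrite [L1 (P1 n.+1 * g)](onf_orth oP1)// scale0r addr0 => gE.
have gA : L1 (P1 n * g) = - (pt^-1 * qt).
  rewrite (onf_inner_coef oP1)//; apply: (mulIf (c1_neq0 n)); rewrite divfK//.
  rewrite coefB coefZ (onf_subleading oP1) (subleadingS _ oP0).
  by rewrite /qt /qtilde /pt /ptilde; field; rewrite c0_neq0 c1_neq0.
move: gE; rewrite gA gL two_term_last /g => /eqP; rewrite subr_eq => /eqP ->.
rewrite mulrBl scalerBr mul_polyC scalerA !scaleNr.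
by rewrite [LHS]addrC addrAC addrA.
Qed.

End Connection.

(** * Matrix-vector form *)

Lemma sum_if_addn (V : nmodType) (N d i : nat) (F : nat -> V) :
  \sum_(k < N) (if i == (k + d)%N then F k else 0) =
  if (d <= i < N + d)%N then F (i - d)%N else 0.
Proof.
rewrite -big_mkcond; case: ifPn => [/andP[di iN]|dN].
  have iN' : (i - d < N)%N by rewrite ltn_subLR// addnC.
  rewrite (big_pred1 (Ordinal iN'))// => k /=.
  by rewrite -val_eqE /= -[RHS](eqn_add2r d) subnK// eq_sym.
rewrite big_pred0// => k; apply: contraNF dN => /eqP ->.
by rewrite leq_addl ltn_add2r ltn_ord.
Qed.

Lemma sum_if_eq (V : nmodType) (N i : nat) (F : nat -> V) :
  \sum_(k < N) (if k == i :> nat then F k else 0) =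
  if (i < N)%N then F i else 0.
Proof.
have := sum_if_addn N 0 i F; rewrite addn0 subn0 leq0n /= => <-.
by apply: eq_bigr => k _; rewrite addn0 eq_sym.
Qed.

Section MatrixForm.
Variables (R : realType) (L : {scalar {poly R}}) (P0 P1 : nat -> {poly R}).
Hypothesis oP0 : orthonormal_for L P0.
Hypothesis oP1 : orthonormal_for (mul_functional ('X^2 - 1) L) P1.

(** The first row of the first matrix identity, which P0_expand leaves out. *)
Lemma P0_expand0 : P0 0 = pcoef P0 P1 0 *: P1 0.
Proof.
rewrite {1}[P0 0](@onf_expand _ _ _ oP1 1) ?(onf_size oP0)//.
by rewrite big_ord1 mulrC mul_functionalM (inner_X2sub1_diag oP0 oP1).
Qed.

(** As a sum over the three diagonals, so that matrix products split into three
sums with at most one term each. *)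
Lemma Jmx_entry n (k : 'I_n.+1) (j : 'I_n.+2) : Jmx P0 P1 n k j =
  (if j == (k + 0)%N :> nat then pcoef P0 P1 k else 0)
  + (if j == (k + 1)%N :> nat then qcoef P0 P1 k else 0)
  + (if j == (k + 2)%N :> nat then rcoef P0 P1 k.+1 else 0).
Proof.
rewrite mxE addn0 addn1 addn2.
have [->|_] := eqVneq (j : nat) k; first by rewrite !ltn_eqF ?addr0.
have [->|_] := eqVneq (j : nat) k.+1; first by rewrite ltn_eqF// add0r addr0.
by rewrite !add0r.
Qed.

Lemma pvec_P0E n : pvec P0 n.+1 =
  (polymx (Jmx P0 P1 n))^T *m pvec P1 n
  + (pcoef P0 P1 n.+1 *: P1 n.+1) *: elast R n.+1.
Proof.
apply/colP => i; rewrite !mxE.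
under eq_bigr => k _.
  rewrite mxE [polymx _ _ _]mxE Jmx_entry mxE mul_polyC !scalerDl.
  rewrite !(fun_if (fun x => x *: P1 k)) scale0r.
  over.
rewrite !big_split /=.
rewrite (sum_if_addn _ 0 _ (fun k => pcoef P0 P1 k *: P1 k)).
rewrite (sum_if_addn _ 1 _ (fun k => qcoef P0 P1 k *: P1 k)).
rewrite (sum_if_addn _ 2 _ (fun k => rcoef P0 P1 k.+1 *: P1 k)).
case: i => [[|m] mn]; rewrite -val_eqE /= ?addn0 ?addn1 ?addn2 ?subn0.
  by rewrite mulr0 !addr0 P0_expand0.
rewrite (P0_expand oP0 oP1) subn1 mn /=.
have -> : (if (1 < m.+1 < n.+3)%N
     then rcoef P0 P1 (m.+1 - 2).+1 *: P1 (m.+1 - 2)%N else 0)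
    = rcoef P0 P1 m *: prev_op P1 m.
  case: m mn => [|m] mn /=; first by rewrite scaler0.
  by rewrite ltnW// subSS subn1.
have [->|mNn] := eqVneq m n; first by rewrite ltnn eqxx mulr1; ring.
rewrite eqSS (negPf mNn) mulr0 addr0 ifT; first by ring.
by rewrite ltn_neqAle eqSS mNn.
Qed.

Lemma pvec_X2sub1E n : ('X^2 - 1) *: pvec P1 n =
  polymx (Jmx P0 P1 n) *m pvec P0 n.+1
  + (rcoef P0 P1 n.+1 *: P0 n.+2) *: elast R n.
Proof.
apply/colP => k; rewrite !mxE.
under eq_bigr => j _.
  rewrite [polymx _ _ _]mxE Jmx_entry mxE mul_polyC !scalerDl.
  rewrite !(fun_if (fun x => x *: P0 j)) scale0r.
  over.
rewrite !big_split /=.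
rewrite !(sum_if_eq _ _ (fun j => _ *: P0 j)) addn0 addn1 addn2.
rewrite (X2sub1M_expand oP0 oP1) !ltnS ltnW// leq_ord.
have [->|kNn] := eqVneq k ord_max; first by rewrite ltnn mulr1 addr0.
by rewrite mulr0 addr0 ifT// ltn_neqAle kNn -ltnS /=.
Qed.

End MatrixForm.

(** * The functional of a weight *)

Section Moments.
Variables (R : realType) (w : R -> R).

Local Notation mu := (@lebesgue_measure R).
Local Notation I := (`[1, +oo[%classic : set R).

Definition moment (f : {poly R}) : R :=
  \int[mu]_(x in I) (f.[x] * w x).

Lemma innerE (f g : {poly R}) :
  inner w (horner f) (horner g) = moment (f * g).
Proof. by apply: eq_Rintegral => x _; rewrite hornerM. Qed.

Hypothesis mw : measurable_fun setT w.
Hypothesis w_ge0 : forall x, 1 <= x -> 0 <= w x.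

Let mfw (f : {poly R}) : measurable_fun I (fun x => f.[x] * w x).
Proof.
apply: measurable_funTS; apply: measurable_funM => //.
by apply: continuous_measurable_fun; exact: continuous_horner.
Qed.

Let I_ge1 x : I x -> 1 <= x.
Proof. by rewrite /= in_itv /= andbT. Qed.

(** A nonnegative function with infinite integral has real-valued integral 0,
so a nonzero value can only come from a finite integral. *)
Lemma moment_sqr_integrable (f : {poly R}) : moment (f ^+ 2) != 0 ->
  mu.-integrable I (EFin \o (fun x => (f ^+ 2).[x] * w x)).
Proof.
move=> m0; apply/integrableP; split.
  by apply/measurable_EFinP; exact: mfw.
rewrite (_ : (\int[mu]_(x in I) _)%E =
    (\int[mu]_(x in I) ((f ^+ 2).[x] * w x)%:E)%E); last first.
  apply: eq_integral => x /[!inE] /I_ge1 x1 /=.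
  by rewrite ger0_norm// mulr_ge0 ?w_ge0// horner_exp sqr_ge0.
rewrite ltey; apply: contraNneq m0 => oo.
by rewrite /moment /Rintegral oo.
Qed.

Variable P : nat -> {poly R}.
Hypothesis oP : orthonormal_polys w P.

(** Orthonormality makes P_n^2 w integrable for all n.  As P_0 is constant, w
itself is integrable; then so is P_n w, because |y| <= 1 + y^2; and the P_n
span all polynomials. *)
Lemma moment_integrable (f : {poly R}) :
  mu.-integrable I (EFin \o (fun x => f.[x] * w x)).
Proof.
have iP n : mu.-integrable I (EFin \o (fun x => (P n ^+ 2).[x] * w x)).
  apply: moment_sqr_integrable.
  by rewrite expr2 -innerE (inner_op oP) eqxx oner_neq0.
have iD (g h : {poly R}) :
    mu.-integrable I (EFin \o (fun x => g.[x] * w x)) ->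
    mu.-integrable I (EFin \o (fun x => h.[x] * w x)) ->
    mu.-integrable I (EFin \o (fun x => (g + h).[x] * w x)).
  move=> ig ih; apply: eq_integrable (integrableD _ ig ih) => //= x _.
  by rewrite -EFinD hornerD mulrDl.
have iZ a (g : {poly R}) :
    mu.-integrable I (EFin \o (fun x => g.[x] * w x)) ->
    mu.-integrable I (EFin \o (fun x => (a *: g).[x] * w x)).
  move=> ig; apply: eq_integrable (integrableZl _ a ig) => //= x _.
  by rewrite -EFinM hornerZ mulrA.
have P0n0 n : lead_coef (P n) != 0 by rewrite lt0r_neq0// (lead_op oP).
have i1 : mu.-integrable I (EFin \o (fun x => (1 : {poly R}).[x] * w x)).
  have /size1_polyC P0C : (size (P 0) <= 1)%N by rewrite (size_op oP).
  have c0 : (P 0)`_0 != 0 by have := P0n0 0; rewrite P0C lead_coefC coefC.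
  have := iZ ((P 0)`_0 ^+ 2)^-1 _ (iP 0).
  by rewrite P0C coefC /= -polyC_exp -mul_polyC -polyCM mulVf// expf_neq0.
have iPn n : mu.-integrable I (EFin \o (fun x => (P n).[x] * w x)).
  apply: le_integrable (iD _ _ i1 (iP n)) => //.
    by apply/measurable_EFinP; exact: mfw.
  move=> x /I_ge1 x1 /=; rewrite lee_fin !normrM ler_wpM2r//.
  rewrite hornerD hornerC horner_exp; set y := (P n).[x].
  rewrite [leRHS]ger0_norm ?addr_ge0 ?sqr_ge0// -(real_normK (num_real y)).
  by have := sqr_ge0 (`|y| - 2^-1); nra.
have [n] := ubnP (size f); elim: n f => // n IHn f.
rewrite ltnS; case: n IHn => [|n] IHn sf.
  move: sf; rewrite leqn0 size_poly_eq0 => /eqP ->.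
  by rewrite -(scale0r (1 : {poly R})); apply: iZ.
rewrite -(subrK ((f`_n / lead_coef (P n)) *: P n) f).
by apply: iD; [apply: IHn; rewrite ltnS size_sub_top ?(size_op oP)|apply: iZ].
Qed.

Lemma moment_scalar :
  exists L : {scalar {poly R}}, forall f, L f = moment f.
Proof.
suff lin : scalar moment.
  pose H := GRing.isLinear.Build R {poly R} R *%R moment lin.
  by exists (HB.pack_for {scalar {poly R}} moment H).
move=> a f g; rewrite /moment -RintegralZl//; last exact: moment_integrable.
rewrite -RintegralD//; last 2 first.
- apply: eq_integrable (moment_integrable (a *: f)) => //= x _.
  by rewrite hornerZ mulrA.
- exact: moment_integrable.
by apply: eq_Rintegral => x _; rewrite hornerD hornerZ mulrDl mulrA.
Qed.

End Moments.

(** * The two weights *)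

Section Weight.
Variables (R : realType) (zeta : R).

Lemma measurable_weight l : measurable_fun setT (weight l zeta).
Proof.
apply: measurable_funM; last exact: measurableT_comp.
apply: measurable_funM => //.
apply: (measurableT_comp (measurable_powR _)).
exact: measurable_funB.
Qed.

Lemma weight_ge0 l x : 0 <= weight l zeta x.
Proof.
rewrite !mulr_ge0 ?expR_ge0 ?powR_ge0// invr_ge0 Rintegral_ge0// => t _.
by rewrite !mulr_ge0// ?expR_ge0// addr_ge0 ?expR_ge0.
Qed.

(** At x = 1 both sides vanish by the convention 0 `^ a = 0 for a <> 0, so the
identity needs no exceptional point. *)
Lemma weight1E x : 1 <= x -> weight 1 zeta x = (x ^+ 2 - 1) * weight 0 zeta x.
Proof.
move=> x1; have x2 : 0 <= x ^+ 2 - 1.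
  by rewrite subr_ge0 expr_ge1// (le_trans _ x1).
rewrite /weight.
suff -> : (x ^+ 2 - 1) `^ (1%:R - 1 / 2) =
    (x ^+ 2 - 1) * (x ^+ 2 - 1) `^ (0%:R - 1 / 2) by ring.
have [->|y0] := eqVneq (x ^+ 2 - 1) 0.
  by rewrite mul0r powR0// (_ : _ - _ = 2^-1) ?invr_neq0//; field.
rewrite -[X in _ = X * _]powRr1// -powRD; last by rewrite y0 implybT.
by congr (_ `^ _); ring.
Qed.

End Weight.

Theorem theorem3p2 (R : realType) (zeta : R) (P0 P1 : nat -> {poly R}) (n : nat)
    (zeta_gt0 : 0 < zeta)
    (hP0 : orthonormal_polys (weight 0 zeta) P0)
    (hP1 : orthonormal_polys (weight 1 zeta) P1) :
  let p := pcoef P0 P1 in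
  let q := qcoef P0 P1 in
  let r := rcoef P0 P1 in
  let J := polymx (Jmx P0 P1 n) in
  let pt := ptilde P0 P1 in
  let qt := qtilde P0 P1 in
  let rt := rtilde P0 P1 in
  [/\ (* (i), with the second expression for q_n *)
      [/\ ('X^2 - 1) * P1 n = p n *: P0 n + q n *: P0 n.+1 + r n.+1 *: P0 n.+2,
          P0 n.+1 = r n *: prev_op P1 n + q n *: P1 n + p n.+1 *: P1 n.+1
        & q n = lead_coef (P0 n.+1) / lead_coef (P1 n) *
                \sum_(i < n.+1) (zero_op (P1 n.+1) i - zero_op (P0 n.+1) i)],
      (* (i), matrix-vector form *)
      pvec P0 n.+1 =
        J^T *m pvec P1 n + (p n.+1 *: P1 n.+1) *: elast R n.+1
      /\ ('X^2 - 1) *: pvec P1 n =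
        J *m pvec P0 n.+1 + (r n.+1 *: P0 n.+2) *: elast R n
    & (* (ii) *)
      ('X^2 - 1) * P1 n =
        pt n *: (('X + (qt n)%:P) * P0 n.+1) + rt n *: P0 n
      /\ P0 n.+1 =
        (pt n)^-1 *: (('X - (qt n)%:P) * P1 n)
        - (acoef P1 n.-1 / acoef P0 n * rt n) *: prev_op P1 n].
Proof.
move=> p q r J pt qt rt.
have mw0 := measurable_weight zeta 0.
have [L LE] := moment_scalar mw0 (fun x _ => weight_ge0 zeta 0 x) hP0.
have oP0 : orthonormal_for L P0.
  split; [exact: (size_op hP0)|exact: (lead_op hP0)|] => i j.
  by rewrite LE -innerE (inner_op hP0).
have oP1 : orthonormal_for (mul_functional ('X^2 - 1) L) P1.
  split; [exact: (size_op hP1)|exact: (lead_op hP1)|] => i j.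
  rewrite /= LE -(inner_op hP1) innerE; apply: eq_Rintegral => x.
  rewrite inE /= in_itv /= andbT => x1.
  rewrite hornerM weight1E// hornerD hornerN hornerXn hornerC.
  by rewrite [RHS]mulrCA mulrA.
split.
- split; first exact: X2sub1M_expand oP0 oP1 n.
    exact: P0_expand oP0 oP1 n.
  exact: qcoefE oP0 oP1 n.
- by split; [exact: pvec_P0E oP0 oP1 n|exact: pvec_X2sub1E oP0 oP1 n].
- by split; [exact: X2sub1M_two_term oP0 oP1 n|exact: P0_two_term oP0 oP1 n].
Qed.
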